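(* Let $(A_n)_{n=0}^\infty$ be an Appell sequence with constants $c_k$ defined by $\log f_A(t)=\sum_{k\ge1}c_k\frac{t^k}{k!}$. If $c_k/(k-1)! \in \mathbb{Z}$ for all $k\ge1$, then $A_\lambda \in \mathbb{Z}[x]$ for all partitions $\lambda$.
   Context: An Appell sequence is a sequence of polynomials $(A_n)_{n\ge0}$ with $A_0=1$ and $A_n'=nA_{n-1}$ for $n\ge1$; it satisfies $\sum_k A_k(x)t^k/k!=e^{xt}f_A(t)$ for a formal power series $f_A$ with $f_A(0)=1$. For a partition $\lambda$ of length $r$, let $(n_1,\dots,n_r)=(\lambda_r,\lambda_{r-1}+1,\dots,\lambda_1+r-1)$ and $A_\lambda=\operatorname{Wr}[A_{n_1},\dots,A_{n_r}]/\Delta(n_1,\dots,n_r)$, where $\operatorname{Wr}$ is the Wronskian and $\Delta$ the Vandermonde determinant $\prod_{i<j}(x_j-x_i)$. *)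

(* Defs.v *)
From mathcomp Require Import all_boot all_order all_algebra.
Set Implicit Arguments. Unset Strict Implicit. Unset Printing Implicit Defensive.
Import Order.TTheory GRing.Theory Num.Theory.
Local Open Scope ring_scope.

Section Appell.
Variable R : numFieldType.

Definition appell (A : nat -> {poly R}) : Prop :=
  A 0%N = 1 /\ forall n : nat, (A n.+1)^`() = n.+1%:R *: A n.

(* f_A(t) = sum_k A_k(0) t^k / k!  (so that sum_k A_k(x) t^k/k! = e^{xt} f_A(t)).
   fA_coef A k is the coefficient of t^k in f_A. *)
Definition fA_coef (A : nat -> {poly R}) (k : nat) : R :=
  (A k).[0] / (k`!)%:R.

Definition fA_trunc (A : nat -> {poly R}) (k : nat) : {poly R} :=
  \poly_(j < k.+1) fA_coef A j.

(* Coefficient of t^k in the formal power series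
   log f_A(t) = sum_{m>=1} (-1)^(m+1)/m (f_A(t) - 1)^m
   (since f_A(0) = 1, only m <= k contribute, and truncating f_A at degree k
   does not change the coefficient of t^k). *)
Definition logfA_coef (A : nat -> {poly R}) (k : nat) : R :=
  \sum_(1 <= m < k.+1)
     ((-1) ^+ m.+1 / m%:R) * ((fA_trunc A k - 1) ^+ m)`_k.

Definition appell_c (A : nat -> {poly R}) (k : nat) : R :=
  (k`!)%:R * logfA_coef A k.

Definition is_int (x : R) : Prop := exists z : int, x = z%:~R.

Definition is_partition (la : seq nat) : Prop :=
  sorted geq la /\ 0%N \notin la.

(* (n_1,...,n_r) = (lambda_r, lambda_{r-1}+1, ..., lambda_1 + r - 1),
   0-indexed: n_j = lambda_{r-j} + j  for j = 0..r-1. *)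
Definition part_n (la : seq nat) (j : nat) : nat :=
  (nth 0%N la (size la - 1 - j) + j)%N.

Definition wronskian_part (A : nat -> {poly R}) (la : seq nat) : {poly R} :=
  \det (\matrix_(i < size la, j < size la) (A (part_n la j))^`(i)).

Definition vandermonde_part (la : seq nat) : R :=
  \prod_(i < size la) \prod_(j < size la | (i < j)%N)
     ((part_n la j)%:R - (part_n la i)%:R).

Definition appell_schur (A : nat -> {poly R}) (la : seq nat) : {poly R} :=
  (vandermonde_part la)^-1 *: wronskian_part A la.

End Appell.

(* Main.v *)
Require Import Defs.
From mathcomp Require Import all_boot all_order all_algebra.
From mathcomp Require Import all_fingroup all_field all_character mpoly ring.
Set Implicit Arguments. Unset Strict Implicit. Unset Printing Implicit Defensive.
Import Order.TTheory GRing.Theory Num.Theory GroupScope.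
Local Open Scope ring_scope.

(** With [h_k = A_k / k!], [p_1 = x + c_1] and [p_k = c_k / (k-1)!] for [k > 1],
    Newton's identities [m h_m = sum_k p_k h_(m-k)] hold, and the Wronskian is
    [prod_j n_j!] times the Jacobi-Trudi determinant [s = det (h_(n_j - i))].
    For [N = |lambda|] one has [N! s = sum_(w in S_N) chi(w) p_w], where [p_w] is
    the product of the [p_k] over the cycle lengths [k] of [w] and [chi] is given
    by Frobenius' formula, so that [chi] is an alternating sum of permutation
    characters of [S_N].  Taking power sums for the [p_k], the bialternant formula
    gives [chi] norm 1, hence [chi] is an irreducible character up to sign.
    As [chi(1) = N! Delta(n) / prod_j n_j!], it follows that
    [A_lambda = sum_w (chi(w) / chi(1)) p_w = sum_C (|C| chi(C) / chi(1)) p_C]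
    over the conjugacy classes [C], and the [|C| chi(C) / chi(1)] are rational
    algebraic integers. *)

(** * Orbits of permutations and the cycle index *)

Section Orbits.
Variable T : finType.
Implicit Types (s t : {perm T}) (D : {set T}) (x y : T).

Lemma porbit_stable s y z : (s z \in porbit s y) = (z \in porbit s y).
Proof. by rewrite -!eq_porbit_mem (porbit_perm s 1). Qed.

Lemma porbit_sub_closed s D x :
  x \in D -> {in D, forall y, s y \in D} -> porbit s x \subset D.
Proof.
move=> Dx clD; apply/subsetP=> _ /porbitP[i ->].
by elim: i => [|i IHi]; rewrite ?perm1 // expgSr permM clD.
Qed.

Lemma eq_in_porbit s t x : {in porbit s x, s =1 t} -> porbit s x = porbit t x.
Proof.
move=> est; apply/porbit_setP=> y.
suff eX i : (s ^+ i)%g x = (t ^+ i)%g x.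
  by apply/porbitP/porbitP=> -[i ->]; exists i.
elim: i => [|i IHi]; first by rewrite !expg0.
by rewrite !expgSr !permM -IHi est ?mem_porbit.
Qed.

Lemma porbit_fix s x : s x = x -> porbit s x = [set x].
Proof.
move=> sx; apply/eqP; rewrite eqEsubset sub1set porbit_id andbT.
by apply: porbit_sub_closed => [|y /set1P->]; rewrite ?sx set11.
Qed.

Lemma porbit_perm_on s D x : perm_on D s -> x \in D -> porbit s x \subset D.
Proof. by move=> sD Dx; apply: porbit_sub_closed => // y; rewrite perm_closed. Qed.

Lemma porbitJ s t x : porbit (s ^ t)%g (t x) = t @: porbit s x.
Proof.
apply/setP=> y; apply/porbitP/imsetP=> [[i ->]|[z /porbitP[i ->] ->]].
  by exists ((s ^+ i)%g x); rewrite ?mem_porbit // -conjXg permJ.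
by exists i; rewrite -conjXg permJ.
Qed.

Lemma porbitsJ s t : porbits (s ^ t)%g = (fun C : {set T} => t @: C) @: porbits s.
Proof.
apply/setP=> C; apply/imsetP/imsetP=> [[x _ ->]|[_ /imsetP[x _ ->] ->]].
  by exists (porbit s (t^-1%g x)); rewrite ?imset_f // -porbitJ permKV.
by exists (t x); rewrite // porbitJ.
Qed.

Section TpermSplit.
Variables (t : {perm T}) (x b : T).
Hypotheses (neq_xb : x != b) (tb : t b = b).
Let s := (tperm x b * t)%g.

Let sx : s x = b. Proof. by rewrite permM tpermL. Qed.
Let sb : s b = t x. Proof. by rewrite permM tpermR. Qed.
Let s_other y : y != x -> y != b -> s y = t y.
Proof. by move=> yx yb; rewrite permM tpermD // eq_sym. Qed.
Let fix_b_notin y : y != b -> b \notin porbit t y.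
Proof. by move=> yb; rewrite porbit_sym (porbit_fix tb) inE. Qed.

(** Products of permutations act left factor first, so [s] maps [x] to [b] and [b] to [t x]: the
    fixed point [b] of [t] is inserted into the cycle of [x], right after [x]. *)
Lemma porbit_tperm_mul : porbit s x = b |: porbit t x.
Proof.
apply/eqP; rewrite eqEsubset; apply/andP; split.
  apply: porbit_sub_closed => [|y]; first by rewrite !inE porbit_id orbT.
  rewrite !inE => /predU1P[->|ty]; first by rewrite sb porbit_stable porbit_id orbT.
  have [->|yx] := eqVneq y x; first by rewrite sx eqxx.
  have yb : y != b by apply: contraTneq ty => ->; apply: fix_b_notin.
  by rewrite s_other // porbit_stable ty orbT.
have b_in : b \in porbit s x by rewrite -sx porbit_stable porbit_id.
rewrite subUset sub1set b_in /=.
(* The orbit of [x] under [s], deprived of [b], is closed under [t]. *)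
apply: subset_trans (subD1set _ b); apply: porbit_sub_closed.
  by rewrite !inE neq_xb porbit_id.
move=> y; rewrite !inE => /andP[yb sy]; rewrite -{1}tb (inj_eq perm_inj) yb /=.
have [->|yx] := eqVneq y x; first by rewrite -sb porbit_stable.
by rewrite -s_other // porbit_stable.
Qed.

Lemma card_porbit_tperm_mul : #|porbit s x| = #|porbit t x|.+1.
Proof. by rewrite porbit_tperm_mul cardsU1 fix_b_notin. Qed.

(** Away from [x] the two permutations have the same orbits, except for the orbit [[set b]] of [t],
    which [D :\ b] excludes. *)
Lemma mem_porbits_tperm_mul D (C : {set T}) :
  (C \in porbits s) && ((C \subset D) && (x \notin C)) =
  (C \in porbits t) && ((C \subset D :\ b) && (x \notin C)).
Proof.
rewrite subsetD1; apply/and3P/and3P=> [[/imsetP[y _ ->] CD xC]|[/imsetP[y _ ->]]].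
  have b_in : b \in porbit s x by rewrite -sx porbit_stable porbit_id.
  have bC : b \notin porbit s y.
    by apply: contra xC; rewrite -!eq_porbit_mem in b_in *; rewrite (eqP b_in).
  have e : porbit s y = porbit t y.
    apply: eq_in_porbit => z sz; apply: s_other.
      by apply: contraNneq xC => <-.
    by apply: contraNneq bC => <-.
  by split; rewrite // ?CD // e imset_f.
case/andP=> CD bC xC.
have e : porbit t y = porbit s y.
  apply: eq_in_porbit => z sz; rewrite s_other //.
    by apply: contraNneq xC => <-.
  by apply: contraNneq bC => <-.
by split; rewrite // e imset_f.
Qed.

End TpermSplit.
End Orbits.

Section CycleIndex.
Variables (R : comNzRingType) (p : nat -> R).

Definition cyc_prod (T : finType) (s : {perm T}) : R :=
  \prod_(C in porbits s) p #|C|.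

Lemma cyc_prodJ (T : finType) (s t : {perm T}) :
  cyc_prod (s ^ t)%g = cyc_prod s.
Proof.
rewrite /cyc_prod porbitsJ big_imset /=; last first.
  by move=> C D _ _; apply: imset_inj; apply: perm_inj.
by apply: eq_bigr => C _; rewrite card_imset //; apply: perm_inj.
Qed.

(** The bound [N] allows [h] to be the coefficients of a truncated power series, for which Newton's
    identities hold only in low degree. *)
Definition newton_upto N (h : nat -> R) :=
  h 0%N = 1 /\ forall m, (m < N)%N ->
    m.+1%:R * h m.+1 = \sum_(k < m.+1) p k.+1 * h (m - k)%N.

Section SumOverPerms.
Variable T : finType.

(** Permutations of a subset are permutations of [T] supported on it; the condition [C \subset S]
    drops the trivial orbits outside [S]. *)
Let F (S : {set T}) := \sum_(s : {perm T} | perm_on S s)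
  \prod_(C in porbits s | C \subset S) p #|C|.

(** The orbit of [x] gets a weight [u] of its own, so that cutting a point out of this orbit becomes
    a shift of [u]. *)
Let W (S : {set T}) x (u : nat -> R) := \sum_(s : {perm T} | perm_on S s)
  u #|porbit s x| * \prod_(C in porbits s | (C \subset S) && (x \notin C)) p #|C|.

Let F_W (S : {set T}) x : x \in S -> F S = W S x p.
Proof.
move=> Sx; apply: eq_bigr => s sS.
rewrite (bigD1 (porbit s x)) /=; last by rewrite imset_f // porbit_perm_on.
congr (_ * _); apply: eq_bigl => C; rewrite -andbA; apply: andb_id2l => /imsetP[y _ ->].
by rewrite eq_porbit_mem porbit_sym.
Qed.

(* Either [s] fixes [x], or [b = s x] can be cut out of the orbit of [x]. *)
Let W_rec (S : {set T}) x u : x \in S ->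
  W S x u = u 1%N * F (S :\ x) + \sum_(b in S :\ x) W (S :\ b) x (fun k => u k.+1).
Proof.
move=> Sx; rewrite /W (partition_big (fun s : {perm T} => s x) (mem S)) /=; last first.
  by move=> s sS; rewrite perm_closed.
rewrite (big_setD1 x) //=; congr (_ + _).
  rewrite mulr_sumr; apply: eq_big => s.
    apply/andP/idP=> [[sS /eqP sx]|sS].
      apply/subsetP=> y; rewrite !inE => sy; apply/andP; split.
        by apply: contraNneq sy => ->; rewrite sx.
      by apply: contraNT sy => /(out_perm sS)->.
    split; first by apply: subset_trans sS (subD1set _ _).
    by rewrite (out_perm sS) // !inE eqxx.
  case/andP=> sS /eqP sx; rewrite (porbit_fix sx) cards1; congr (_ * _).
  by apply: eq_bigl => C; rewrite subsetD1.
apply: eq_bigr => b; rewrite !inE => /andP[bx Sb].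
rewrite (reindex_inj (mulgI (tperm x b))) /=; apply: eq_big => t.
  rewrite permM tpermL; apply/andP/idP=> [[sS /eqP tb]|sS].
    apply/subsetP=> y; rewrite !inE => ty.
    have yb : y != b by apply: contraNneq ty => ->; rewrite tb.
    rewrite yb /=; have [->//|yx] := eqVneq y x.
    apply: contraNT ty => Sy; rewrite -{2}(out_perm sS Sy) permM tpermD //.
      by rewrite eq_sym.
    by rewrite eq_sym.
  have tb : t b = b by rewrite (out_perm sS) // !inE eqxx.
  split; last by rewrite tb.
  apply/subsetP=> y; rewrite inE permM => ty; apply: contraNT ty => Sy.
  have yx : x != y by apply: contraNneq Sy => <-.
  have yb : b != y by apply: contraNneq Sy => <-.
  by rewrite tpermD // (out_perm sS) // !inE negb_and Sy orbT.
rewrite permM tpermL => /andP[_ /eqP tb].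
have xb : x != b by rewrite eq_sym.
rewrite card_porbit_tperm_mul //; congr (_ * _).
by apply: eq_bigl => C; rewrite mem_porbits_tperm_mul.
Qed.

Let F_newton N h m (S : {set T}) : newton_upto N h -> (m <= N)%N -> #|S| = m ->
  F S = m`!%:R * h m.
Proof.
case=> h0 hS; have [k] := ubnP m; elim: k m S => // k IHk [|m] S.
  move=> _ _ /eqP; rewrite cards_eq0 => /eqP->; rewrite /F h0 mulr1 (big_pred1 1%g).
    rewrite big_pred0 // => C; apply: contraTF isT => /= /andP[/imsetP[x _ ->]].
    by rewrite subset0 => /eqP/setP/(_ x); rewrite porbit_id inE.
  move=> s; apply/idP/eqP=> [s0|->]; last exact: perm_on1.
  by apply/permP=> x; rewrite perm1 (out_perm s0) ?inE.
rewrite ltnS => ltmk ltmN cS.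
have /card_gt0P[x Sx] : (0 < #|S|)%N by rewrite cS.
(* Unrolling [W_rec] for an arbitrary weight [u], with [i.+1] the length of the orbit of [x]; at
   [u = p] Newton's identity evaluates the sum. *)
suff WE : forall j (S' : {set T}) u, (j <= m)%N -> #|S'| = j.+1 -> x \in S' ->
    W S' x u = j`!%:R * \sum_(i < j.+1) u i.+1 * h (j - i)%N.
  by rewrite (F_W Sx) (WE m) // -hS // mulrA -natrM mulnC -factS.
elim=> [|j IHj] S' u ljm cS' Sx'; rewrite W_rec //.
  have cS0 : #|S' :\ x| = 0%N by move: cS'; rewrite (cardsD1 x) Sx' => -[].
  rewrite (IHk 0%N) // ?(leq_ltn_trans _ ltmk) //.
  move/eqP: (cS0); rewrite cards_eq0 => /eqP->; rewrite big_set0 addr0.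
  by rewrite big_ord1 h0 fact0 !mul1r mulr1.
have cS1 : #|S' :\ x| = j.+1 by move: cS'; rewrite (cardsD1 x) Sx' => -[].
rewrite (IHk j.+1) //; last exact: leq_trans ljm (ltnW ltmN); last first.
  exact: leq_ltn_trans ljm ltmk.
rewrite big_ord_recl /= subn0 mulrDr; congr (_ + _); first by rewrite mulrCA.
rewrite (eq_bigr (fun=> j`!%:R * \sum_(i < j.+1) u i.+2 * h (j - i)%N)).
  by rewrite sumr_const cS1 -[LHS]mulr_natl mulrA -natrM -factS.
move=> b; rewrite !inE => /andP[bx Sb]; rewrite IHj ?(ltnW ljm) //.
  by move: cS'; rewrite (cardsD1 b) Sb => -[].
by rewrite !inE eq_sym bx.
Qed.

(** The cycle index expansion of a complete symmetric function in power sums, cleared of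
    denominators so that it holds in every commutative ring. *)
Lemma sum_cyc_prod h : newton_upto #|T| h ->
  \sum_(s : {perm T}) cyc_prod s = #|T|`!%:R * h #|T|.
Proof.
move=> hN; rewrite -(F_newton (S := setT) hN) ?cardsT //; apply: eq_big => s.
  by apply/esym/subsetP=> x; rewrite !inE.
by move=> _; apply: eq_bigl => C; rewrite subsetT andbT.
Qed.

End SumOverPerms.

(** Expanding the product chooses one colour per orbit, that is, a colouring constant on the orbits
    of [s]. *)
Lemma powersum_cyc_prod (T I : finType) (y : I -> R) (s : {perm T}) :
  \prod_(C in porbits s) (\sum_i y i ^+ #|C|) =
  \sum_(f : {ffun T -> I} | [forall x, f (s x) == f x]) \prod_x y (f x).
Proof.
pose O := {C : {set T} | C \in porbits s}.
have Oin x : porbit s x \in porbits s by apply: imset_f.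
pose o x : O := exist _ (porbit s x) (Oin x).
have pick_o (C : O) : {x | o x = C}.
  case: C => C /= Cs; have : exists x, porbit s x == C.
    by case/imsetP: Cs => x _ ->; exists x.
  by case/sigW=> x /eqP xC; exists x; apply: val_inj.
(* A point in each orbit: an invariant colouring is determined by its values at these points. *)
pose rp C := sval (pick_o C).
have rpK C : o (rp C) = C by rewrite /rp; case: (pick_o C).
rewrite big_sub bigA_distr_bigA /=.
pose ext (g : {ffun O -> I}) : {ffun T -> I} := [ffun x => g (o x)].
pose res (f : {ffun T -> I}) : {ffun O -> I} := [ffun C => f (rp C)].
have o_s x : o (s x) = o x by apply: val_inj; rewrite /= (porbit_perm s 1).
rewrite (reindex_onto ext res) /= => [|f /forallP finv]; last first.
  apply/ffunP=> x; rewrite !ffunE; set z := rp _.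
  have /porbitP[i ->] : z \in porbit s x.
    by rewrite -eq_porbit_mem; apply/eqP; exact: (congr1 val (rpK (o x))).
  elim: i => [|i IHi]; first by rewrite perm1.
  by rewrite expgSr permM (eqP (finv _)).
apply: eq_big => [g|g _].
  apply/esym/andP; split; first by apply/forallP=> x; rewrite !ffunE o_s.
  by apply/eqP/ffunP=> C; rewrite !ffunE rpK.
rewrite (partition_big o xpredT) //=; apply: eq_bigr => C _.
rewrite (eq_bigr (fun=> y (g C))) => [|x /eqP oxC]; last by rewrite ffunE oxC.
rewrite prodr_const; congr (_ ^+ _); apply: eq_card => x.
have valC : val C = porbit s (rp C) by rewrite -{1}(rpK C).
rewrite valC -eq_porbit_mem -valC; apply/esym.
by rewrite unfold_in -val_eqE.
Qed.

End CycleIndex.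

(** * Newton's identities and colourings *)

Section Newton.
Variable R : comNzRingType.
Implicit Types (p q h : nat -> R) (H G : {poly R}).

Lemma eq_newton N p q h g : (forall k, (0 < k)%N -> p k = q k) ->
  (forall k, (k <= N)%N -> h k = g k) ->
  newton_upto p N h -> newton_upto q N g.
Proof.
move=> epq ehg [h0 hS]; split=> [|m ltmN]; first by rewrite -ehg.
rewrite -ehg // hS //; apply: eq_bigr => k _; rewrite epq // ehg //.
exact: leq_trans (leq_subr _ _) (ltnW ltmN).
Qed.

(** Newton's identities are the coefficients of the differential equation [H' = P H] with [P] the
    generating function of the [p k.+1]. *)
Lemma newton_polyP N p H :
  newton_upto p N (fun k => H`_k) <->
  H`_0 = 1 /\ forall m, (m < N)%N -> H^`()`_m = (\poly_(k < N) p k.+1 * H)`_m.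
Proof.
suff E m : (m < N)%N ->
    (m.+1%:R * H`_m.+1 = \sum_(k < m.+1) p k.+1 * H`_(m - k)) <->
    (H^`()`_m = (\poly_(k < N) p k.+1 * H)`_m).
  by split=> -[h0 hS]; split=> // m ltmN; apply/E=> //; apply: hS.
move=> ltmN; rewrite coef_deriv mulr_natl coefM.
rewrite [X in _ <-> _ = X](_ : _ = \sum_(k < m.+1) p k.+1 * H`_(m - k)) //.
by apply: eq_bigr => k _; rewrite coef_poly (leq_trans (ltn_ord k)).
Qed.

(** Logarithmic derivatives add under multiplication. *)
Lemma newton_mul N p q H G :
  newton_upto p N (fun k => H`_k) -> newton_upto q N (fun k => G`_k) ->
  newton_upto (fun k => p k + q k) N (fun k => (H * G)`_k).
Proof.
move=> /newton_polyP[H0 HS] /newton_polyP[G0 GS]; apply/newton_polyP.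
split=> [|m ltmN]; first by rewrite coefM big_ord1 H0 G0 mulr1.
set P := \poly_(k < N) p k.+1 in HS; set Q := \poly_(k < N) q k.+1 in GS.
have -> : \poly_(k < N) (p k.+1 + q k.+1) = P + Q.
  by apply/polyP=> k; rewrite coefD !coef_poly; case: ifP; rewrite ?addr0.
rewrite derivM mulrDl !coefD; congr (_ + _).
  rewrite mulrA !coefM; apply: eq_bigr => k _; rewrite HS //.
  exact: leq_trans (ltn_ord k) _.
rewrite mulrCA !coefM; apply: eq_bigr => k _; rewrite GS //.
exact: leq_ltn_trans (leq_subr _ _) _.
Qed.

Lemma newton_prod N (I : Type) (r : seq I) (p : I -> nat -> R) (H : I -> {poly R}) :
  (forall i, newton_upto (p i) N (fun k => (H i)`_k)) ->
  newton_upto (fun k => \sum_(i <- r) p i k) N (fun k => (\prod_(i <- r) H i)`_k).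
Proof.
move=> nH; elim: r => [|i r IHr].
  split=> [|m _]; first by rewrite big_nil coef1.
  rewrite big_nil coef1 mulr0 big1 // => k _; rewrite big_nil mul0r //.
apply: eq_newton (newton_mul (nH i) IHr) => [k _|k _]; by rewrite big_cons.
Qed.

Lemma newton_scale N p h y :
  newton_upto p N h -> newton_upto (fun k => p k * y ^+ k) N (fun k => h k * y ^+ k).
Proof.
case=> h0 hS; split=> [|m ltmN]; first by rewrite h0 mulr1.
rewrite mulrA hS // mulr_suml; apply: eq_bigr => k _.
by rewrite mulrACA -exprD addSn subnKC // -ltnS.
Qed.

Lemma newton_geometric N (y : R) :
  newton_upto (fun k => y ^+ k) N (fun k => y ^+ k).
Proof.
split=> // m _; rewrite (eq_bigr (fun=> y ^+ m.+1)) => [|k _].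
  by rewrite sumr_const card_ord mulr_natl.
by rewrite -exprD addSn subnKC // -ltnS.
Qed.

End Newton.

Lemma newton_rmorph (R S : comNzRingType) (f : {rmorphism R -> S}) p N h :
  newton_upto p N h -> newton_upto (f \o p) N (f \o h).
Proof.
case=> h0 hS; split=> [|m ltmN] /=; first by rewrite h0 rmorph1.
rewrite -(rmorph_nat f) -rmorphM hS // rmorph_sum.
by apply: eq_bigr => k _; rewrite rmorphM.
Qed.

Section Colourings.
Variables (T : finType) (r : nat).

Definition content (f : {ffun T -> 'I_r}) : 'X_{1..r} := (\sum_x U_(f x))%MM.

Definition fixed_colourings (a : 'X_{1..r}) (s : {perm T}) : nat :=
  #|[set f : {ffun T -> 'I_r} | [forall x, f (s x) == f x] & content f == a]|.

Lemma powersum_cyc_prodX (B : comNzRingType) (s : {perm T}) :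
  \prod_(C in porbits s) (\sum_(i < r) 'X_i ^+ #|C|) =
  \sum_(f : {ffun T -> 'I_r} | [forall x, f (s x) == f x]) 'X_[B, content f].
Proof.
rewrite powersum_cyc_prod; apply: eq_bigr => f _.
by rewrite /content mprodXE.
Qed.

(** Multiply each [p k] by the [k]-th power sum of the variables. The matching complete functions
    are the coefficients of the product over [i] of the series with terms [h k * 'X_i ^+ k]; the
    claim compares the coefficients of the monomial [a] in [sum_cyc_prod]. *)
Lemma sum_fixed_colourings (B : comNzRingType) (p h : nat -> B) (a : 'X_{1..r}) :
  newton_upto p #|T| h -> mdeg a = #|T| ->
  \sum_(s : {perm T}) (fixed_colourings a s)%:R * cyc_prod p s
    = #|T|`!%:R * \prod_(i < r) h (a i).
Proof.
set N := #|T| => nh da.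
pose q k : {mpoly B[r]} := (p k)%:MP * \sum_(i < r) 'X_i ^+ k.
pose H i : {poly {mpoly B[r]}} := \poly_(k < N.+1) ((h k)%:MP * 'X_i ^+ k).
have nq : newton_upto q N (fun k => (\prod_(i < r) H i)`_k).
  apply: (@eq_newton _ _ (fun k => \sum_(i < r) (p k)%:MP * 'X_i ^+ k)) => //.
    by move=> k _; rewrite -mulr_sumr.
  apply: newton_prod => i.
  apply: eq_newton (newton_scale 'X_i (newton_rmorph (@mpolyC r B) nh)) => // k lek.
  by rewrite coef_poly ltnS lek.
have /(congr1 (mcoeff a)) := sum_cyc_prod nq.
rewrite mulr_natl mcoeffMn -[X in _ = X -> _]mulr_natl raddf_sum /= => E.
transitivity (\sum_(s : {perm T}) (cyc_prod q s)@_a).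
  apply: eq_bigr => s _.
  have -> : cyc_prod q s = (cyc_prod p s)%:MP *
      \sum_(f : {ffun T -> 'I_r} | [forall x, f (s x) == f x]) 'X_[content f].
    by rewrite -powersum_cyc_prodX /cyc_prod big_split /= rmorph_prod.
  rewrite mcoeffCM mulrC; congr (_ * _); rewrite raddf_sum /=.
  rewrite /fixed_colourings -sum1_card natr_sum big_mkcond [RHS]big_mkcond /=.
  by apply: eq_bigr => f _; rewrite inE mcoeffX; do 2 case: ifP => //=; case: eqP.
rewrite {}E; congr (_ * _).
have aN i : (a i < N.+1)%N by rewrite ltnS -da mdegE (bigD1 i) //= leq_addr.
(* The only choice of one term per factor whose monomial is [a]; its total degree is [N] since
   [mdeg a = N]. *)
pose ea : {ffun 'I_r -> 'I_N.+1} := [ffun i => Ordinal (aN i)].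
have coefE (e : {ffun 'I_r -> 'I_N.+1}) :
    ((\prod_(i < r) (((h (e i))%:MP * 'X_i ^+ e i) *: 'X^(e i)))`_N)@_a =
    (\prod_(i < r) h (e i)) * ((\sum_i e i == N)%N && ([multinom e i | i < r] == a))%:R.
  rewrite scaler_prod prodrXr big_split /= -rmorph_prod coefZ coefXn.
  have -> : \prod_(i < r) 'X_i ^+ e i = 'X_[B, [multinom e i | i < r]].
    by rewrite mpolyXE_id; apply: eq_bigr => i _; rewrite mnmE.
  rewrite eq_sym; case: eqP => _; rewrite ?mulr1 ?mulr0 ?mcoeff0 //.
  by rewrite mcoeffCM mcoeffX.
under eq_bigr => i _ do rewrite /H poly_def.
rewrite bigA_distr_bigA /= coef_sum raddf_sum /= (eq_bigr _ (fun e _ => coefE e)).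
rewrite (bigD1 ea) //= [X in _ + X]big1 ?addr0.
  rewrite (_ : [multinom _ | i < r] = a); last first.
    by apply/mnmP=> i; rewrite mnmE ffunE.
  rewrite eqxx andbT (_ : (_ == _) = true) ?mulr1; last first.
    apply/eqP/(etrans _ da); rewrite mdegE.
    by apply: eq_bigr => i _; rewrite ffunE.
  by apply: eq_bigr => i _; rewrite ffunE.
move=> e ne; case: eqP => _; rewrite ?mulr0 //=.
case: eqP => [ea'|_]; rewrite ?mulr0 //; case/eqP: ne.
by apply/ffunP=> i; apply: val_inj; rewrite ffunE /= -ea' mnmE.
Qed.

End Colourings.

(** * Frobenius' formula *)

(** The test sets [h] to zero at negative indices, where truncated subtraction would give [h 0]. *)
Definition jacobi_trudi (B : comNzRingType) r (n : 'I_r -> nat) (h : nat -> B) :=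
  \matrix_(i < r, j < r) (if (i <= n j)%N then h (n j - i)%N else 0).

(** * The bialternant formula *)

Section Bialternant.
Variables (B : comNzRingType) (r M : nat) (y : 'I_r -> B).

(** The series of [1 / (1 - y i t)] cut after degree [M]; up to that degree [h] below is the
    complete symmetric function of the [y i]. *)
Let geo (i : 'I_r) : {poly B} := \poly_(j < M.+1) y i ^+ j.
Let h k := (\prod_i geo i)`_k.

Let one_sub_geo i : (1 - y i *: 'X) * geo i = 1 - (y i ^+ M.+1) *: 'X^(M.+1).
Proof.
rewrite /geo poly_def.
have -> : \sum_(j < M.+1) y i ^+ j *: 'X^j = \sum_(j < M.+1) (y i *: 'X) ^+ j.
  by apply: eq_bigr => j _; rewrite exprZn.
by rewrite -exprZn -[RHS]opprB subrX1 -mulNr opprB.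
Qed.

(** Its coefficients are the signed elementary symmetric functions of the variables other than
    [y k]. Multiplying by all the [geo i] leaves [geo k] modulo degree [M.+1], which expresses
    powers of [y k] through [h]. *)
Let e (k : 'I_r) := \prod_(j | j != k) (1 - y j *: 'X).

Let e_geo k : exists Q, e k * \prod_i geo i = geo k * (1 + 'X^(M.+1) * Q).
Proof.
rewrite (bigD1 k) //= mulrCA -big_split /=.
suff [Q ->] : exists Q, \prod_(i | i != k) ((1 - y i *: 'X) * geo i) = 1 + 'X^(M.+1) * Q.
  by exists Q.
apply: (big_ind (fun P => exists Q, P = 1 + 'X^(M.+1) * Q)).
- by exists 0; rewrite mulr0 addr0.
- by move=> _ _ [Q ->] [Q' ->]; exists (Q + Q' + Q * 'X^(M.+1) * Q'); ring.
- by move=> i _; exists (- (y i ^+ M.+1)%:P); rewrite one_sub_geo mulrN mulrC mul_polyC.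
Qed.

Let size_e k : (size (e k) <= r)%N.
Proof.
apply: leq_trans (size_poly_prod_leq _ _) _.
have cK : #|[pred j : 'I_r | j != k]| = r.-1.
  by rewrite (eq_card (B := predC1 k)) // cardC1 card_ord.
rewrite cK; have r_gt0 : (0 < r)%N by apply: leq_ltn_trans (ltn_ord k).
apply: (@leq_trans ((r.-1 * 2).+1 - r.-1)).
  rewrite leq_sub2r // ltnS -cK -sum_nat_const; apply: leq_sum => j _.
  rewrite (leq_trans (size_polyD _ _)) // geq_max size_poly1 size_polyN /=.
  by rewrite (leq_trans (size_scale_leq _ _)) ?size_polyX.
by rewrite muln2 -addnn -addSn addnK prednK.
Qed.

Let expr_y k m : (m <= M)%N ->
  y k ^+ m = \sum_(i < r) (e k)`_i * (if (i <= m)%N then h (m - i) else 0).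
Proof.
move=> lemM; have [Q eQ] := e_geo k.
have <- : (e k * \prod_i geo i)`_m = y k ^+ m.
  rewrite eQ mulrDr mulr1 coefD [geo k * _]mulrC -mulrA coefXnM ltnS lemM addr0.
  by rewrite coef_poly ltnS lemM.
rewrite coefM.
pose F i := (e k)`_i * (if (i <= m)%N then h (m - i) else 0).
transitivity (\sum_(i < m.+1) F i).
  by apply: eq_bigr => i _; rewrite /F ifT // -ltnS.
transitivity (\sum_(i < maxn m.+1 r) F i).
  rewrite (big_ord_widen _ _ (leq_maxl m.+1 r)) big_mkcond /=.
  by apply: eq_bigr => i _; rewrite /F ltnS; case: (_ <= m)%N; rewrite ?mulr0.
rewrite (big_ord_widen _ F (leq_maxr m.+1 r)) [RHS]big_mkcond /=.
apply: eq_bigr => i _; case: ltnP => // leri.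
by rewrite /F nth_default ?mul0r // (leq_trans (size_e k)).
Qed.

(** The alternant factors as a matrix independent of [n] times the Jacobi-Trudi matrix. The
    exponents [0, ..., r - 1] identify the determinant of the first factor with the Vandermonde
    determinant, as their Jacobi-Trudi matrix is unitriangular. *)
Lemma bialternant (n : 'I_r -> nat) : (forall j, n j <= M)%N -> (r <= M.+1)%N ->
  \det (\matrix_(k < r, j < r) y k ^+ n j) =
  \det (\matrix_(k < r, j < r) y k ^+ j) * \det (jacobi_trudi n h).
Proof.
move=> lenM lerM.
have factor (n' : 'I_r -> nat) : (forall j, n' j <= M)%N ->
    \matrix_(k < r, j < r) y k ^+ n' j =
    \matrix_(k < r, i < r) (e k)`_i *m jacobi_trudi n' h.
  move=> le'; apply/matrixP=> k j; rewrite !mxE expr_y //.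
  by apply: eq_bigr => i _; rewrite !mxE.
rewrite factor // det_mulmx (factor (fun j : 'I_r => j)) ?det_mulmx; last first.
  by move=> j; rewrite -ltnS (leq_trans (ltn_ord j)).
suff -> : \det (jacobi_trudi (fun j : 'I_r => nat_of_ord j) h) = 1 by rewrite mulr1.
rewrite -det_tr det_trig; last first.
  by apply/is_trig_mxP=> i j ltij; rewrite !mxE leqNgt ltij.
rewrite big1 // => i _; rewrite !mxE leqnn subnn /h.
rewrite -horner_coef0 horner_prod big1 // => j _.
by rewrite horner_coef0 coef_poly.
Qed.

Lemma newton_complete N : (N <= M)%N ->
  newton_upto (fun k => \sum_i y i ^+ k) N h.
Proof.
move=> leNM; apply: newton_prod => i.
apply: eq_newton (newton_geometric N (y i)) => // k lekN.
by rewrite coef_poly ltnS (leq_trans lekN).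
Qed.

End Bialternant.

Section Frobenius.
Variables (T : finType) (r : nat) (n : 'I_r -> nat).
Let nm : 'X_{1..r} := [multinom n j | j < r].
Let rho (w : 'S_r) : 'X_{1..r} := [multinom nat_of_ord (w j) | j < r].

(* Frobenius' formula: the coefficient of [y^n] in the product of the
   Vandermonde determinant and the power sums of the cycles of [s]. *)
Definition frob_char (s : {perm T}) : int :=
  \sum_(w : 'S_r) (-1) ^+ w *
    (if (rho w <= nm)%MM then fixed_colourings (nm - rho w)%MM s else 0%N)%:Z.

(** The term of [w] in the Vandermonde determinant is a signed monomial of exponent [rho w]; the
    colourings must supply the remaining exponent [nm - rho w]. *)
Lemma frob_char_coef s :
  (\det (\matrix_(k < r, j < r) 'X_k ^+ j) *
     \prod_(C in porbits s) (\sum_(i < r) 'X_i ^+ #|C|) : {mpoly int[r]})@_nm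
  = frob_char s.
Proof.
rewrite /determinant mulr_suml raddf_sum; apply: eq_bigr => w _ /=.
have -> : \prod_(i < r) (\matrix_(k < r, j < r) 'X_k ^+ j) i (w i) = 'X_[int, rho w].
  by rewrite mpolyXE_id; apply: eq_bigr => i _; rewrite !mxE mnmE.
rewrite powersum_cyc_prodX -mulrA !mulr_sign.
rewrite (fun_if (mcoeff nm)) mcoeffN; set c := mcoeff _ _.
suff -> : c = Posz (if (rho w <= nm)%MM
                    then fixed_colourings (nm - rho w)%MM s else 0) by [].
rewrite {}/c.
rewrite mulr_sumr raddf_sum /=.
under eq_bigr => f _ do rewrite -mpolyXD mcoeffX.
case: ifPn => lew; last first.
  rewrite big1 // => f _; case: eqP => // eqn; case/negP: lew.
  by rewrite -eqn lem_addr.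
rewrite /fixed_colourings -sum1_card -natz natr_sum big_mkcond [RHS]big_mkcond /=.
apply: eq_bigr => f _; rewrite inE; case: ifP => //= _.
rewrite -{1}(submK lew) addmC (inj_eq (@addIm _ _)).
by case: eqP.
Qed.

Hypothesis sum_n : (\sum_j n j = #|T| + \sum_(j < r) j)%N.

(** Both sides are expanded over [w]: a Leibniz term is a product of the [h (n j - w j)], which
    [sum_fixed_colourings] evaluates. If some [w j] exceeds [n j], both terms are zero. *)
Lemma sum_frob_char (B : comNzRingType) (p h : nat -> B) :
  newton_upto p #|T| h ->
  \sum_(s : {perm T}) (frob_char s)%:~R * cyc_prod p s =
  #|T|`!%:R * \det (jacobi_trudi n h).
Proof.
move=> nh; rewrite -det_tr /determinant mulr_sumr.
under eq_bigr => s _ do rewrite /frob_char rmorph_sum mulr_suml.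
rewrite exchange_big /=; apply: eq_bigr => w _.
under eq_bigr => s _ do rewrite rmorphM rmorph_sign -mulrA.
rewrite -mulr_sumr mulrCA; congr (_ * _).
case: (boolP (rho w <= nm)%MM) => lew; last first.
  rewrite big1 => [|s _]; last by rewrite mul0r.
  have /existsP[j] : [exists j, ~~ (w j <= n j)%N].
    rewrite -negb_forall; apply: contra lew => /forallP lew.
    by apply/mnm_lepP=> j; rewrite !mnmE.
  by move=> /negPf lt_w; rewrite (bigD1 j) //= !mxE lt_w mul0r mulr0.
transitivity (\sum_(s : {perm T}) (fixed_colourings (nm - rho w)%MM s)%:R * cyc_prod p s).
  by [].
rewrite (sum_fixed_colourings nh); last first.
  apply/eqP; rewrite -(eqn_add2r (mdeg (rho w))) -mdegD submK // !mdegE.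
  under eq_bigr do rewrite mnmE.
  under [X in _ == (_ + X)%N]eq_bigr do rewrite mnmE.
  rewrite sum_n eqn_add2l (reindex_inj (@perm_inj _ w)) //.
congr (_ * _); apply: eq_bigr => j _; rewrite !mxE mnmBE !mnmE.
by move/mnm_lepP/(_ j): lew; rewrite !mnmE => ->.
Qed.

(** With power sums for [p], multiplying [sum_frob_char] by the Vandermonde determinant turns its
    right side into [N!] times an alternant. In the coefficient of [nm], each cycle product on the
    left yields a second factor [frob_char s]. *)
Lemma frob_char_norm : injective n ->
  \sum_(s : {perm T}) frob_char s * frob_char s = #|T|`!%:Z.
Proof.
move=> n_inj; pose y (i : 'I_r) : {mpoly int[r]} := 'X_i.
(* Large enough for Newton's identities up to [#|T|], for every exponent [n j] and for the bound on
   [r]. *)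
pose M := (#|T| + \sum_j n j + r)%N.
pose h k := (\prod_i \poly_(j < M.+1) y i ^+ j)`_k.
have nh : newton_upto (fun k => \sum_i y i ^+ k) #|T| h.
  by apply: newton_complete; rewrite /M -addnA leq_addr.
have /(congr1 (fun q => (\det (\matrix_(k < r, j < r) y k ^+ j) * q)@_nm)) :=
  sum_frob_char nh.
rewrite mulrCA -bialternant; first last.
- by rewrite ltnW // ltnS leq_addl.
- by move=> j; rewrite /M (bigD1 j) //= -addnA addnCA -addnA leq_addr.
rewrite mulr_natl mcoeffMn mulr_sumr raddf_sum /= => E.
transitivity (\sum_(s : {perm T}) (\det (\matrix_(k < r, j < r) y k ^+ j) *
   ((frob_char s)%:~R * cyc_prod (fun k => \sum_i y i ^+ k) s))@_nm).
  apply: eq_bigr => s _; rewrite mulrCA mulrzl.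
  by rewrite -[RHS]/(mcoeff nm _) raddfMz /= frob_char_coef -mulrzl intz.
rewrite {}E.
(* As [n] is injective, only the identity permutation contributes the monomial [nm]. *)
suff -> : (\det (\matrix_(k < r, j < r) y k ^+ n j))@_nm = 1 by rewrite natz.
have prodE (w : 'S_r) : \prod_(i < r) (\matrix_(k < r, j < r) y k ^+ n j) i (w i) =
    'X_[[multinom n (w i) | i < r]].
  by rewrite mpolyXE_id; apply: eq_bigr => i _; rewrite !mxE mnmE.
rewrite /determinant raddf_sum (bigD1 1%g) //= [X in _ + X]big1 ?addr0 => [|w w_neq1].
  rewrite odd_perm1 expr0 mul1r prodE mcoeffX (_ : _ == _) //.
  by apply/eqP/mnmP=> i; rewrite !mnmE perm1.
rewrite prodE mulr_sign (fun_if (mcoeff nm)) mcoeffN mcoeffX.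
case: eqP => [/mnmP eqw|_]; last by rewrite oppr0 if_same.
case/eqP: w_neq1; apply/permP=> i; apply: n_inj.
by have := eqw i; rewrite !mnmE perm1.
Qed.

End Frobenius.

(** * Characters of the symmetric group *)

Lemma permutation_character (gT : finGroupType) (X : finType) (to : X -> gT -> X)
    (S : {set X}) :
  (forall x, to x 1%g = x) -> (forall x a b, to x (a * b)%g = to (to x a) b) ->
  (forall x a, x \in S -> to x a \in S) ->
  exists2 phi : 'CF([set: gT]), phi \is a character &
    forall a, phi a = #|[set x in S | to x a == x]|%:R.
Proof.
move=> to1 toM toS.
(* Row [i] has its single 1 at the image of point [i], so a right action is multiplicative in this
   order, and the trace counts fixed points. *)
pose rG a : 'M[algC]_#|S| := \matrix_(i, j) (to (enum_val i) a == enum_val j)%:R.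
have rG_repr : mx_repr [set: gT] rG.
  split=> [|a b _ _]; apply/matrixP=> i j; rewrite !mxE.
    by rewrite to1 (inj_eq enum_val_inj).
  have Si := toS _ a (enum_valP i).
  rewrite (bigD1 (enum_rank_in Si (to (enum_val i) a))) //= !mxE.
  rewrite enum_rankK_in // eqxx mul1r -toM big1 ?addr0 // => k nek.
  rewrite !mxE; case: eqP => [ek|_]; last by rewrite mul0r.
  by case/eqP: nek; apply: enum_val_inj; rewrite enum_rankK_in.
exists (cfRepr (MxRepresentation rG_repr)); first exact: cfRepr_char.
move=> a; rewrite cfunE inE mulr1n /mxtrace.
under eq_bigr => i _ do rewrite mxE.
rewrite -(big_enum_val (fun x => (to x a == x)%:R)) /= -sum1_card natr_sum.
rewrite big_mkcond [RHS]big_mkcond; apply: eq_bigr => x _.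
by rewrite inE; case: (x \in S); case: eqP.
Qed.

Section SymmetricGroup.
Variables (T : finType) (r : nat) (n : 'I_r -> nat).
Notation G := [set: {perm T}].

Lemma fixed_colourings_character (a : 'X_{1..r}) :
  exists2 phi : 'CF(G), phi \is a character &
    forall s, phi s = (fixed_colourings a s)%:R.
Proof.
(* The inverse makes precomposition a right action. *)
pose to (f : {ffun T -> 'I_r}) (s : {perm T}) : {ffun T -> 'I_r} :=
  [ffun x => f (s^-1%g x)].
have [|f s t|f s|phi char_phi phiE] :=
    @permutation_character _ _ to [set f | content f == a].
- by move=> f; apply/ffunP=> x; rewrite ffunE invg1 perm1.
- by apply/ffunP=> x; rewrite !ffunE invMg permM.
- rewrite !inE => /eqP <-; apply/eqP; rewrite /content (reindex_inj (@perm_inj _ s)).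
  by apply: eq_bigr => x _; rewrite ffunE permK.
exists phi => // s; rewrite phiE; congr _%:R; apply: eq_card => f; rewrite !inE andbC.
apply: andb_id2r => _; apply/eqP/forallP=> [fs x|fs].
  by rewrite -{1}fs ffunE permK.
by apply/ffunP=> x; rewrite ffunE -(eqP (fs _)) permKV.
Qed.

Lemma frob_char_vchar :
  exists2 phi : 'CF(G), phi \in 'Z[irr G] & forall s, phi s = (frob_char n s)%:~R.
Proof.
pose a (w : 'S_r) : 'X_{1..r} :=
  ([multinom n j | j < r] - [multinom nat_of_ord (w j) | j < r])%MM.
pose ok (w : 'S_r) := ([multinom nat_of_ord (w j) | j < r] <= [multinom n j | j < r])%MM.
have /fin_all_exists[phi phiP] w : exists phi : 'CF(G), phi \is a character /\
    forall s, phi s = (if ok w then fixed_colourings (a w) s else 0%N)%:R.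
  case: (ok w); last by exists 0; split=> [|s]; rewrite ?rpred0 ?cfunE.
  by have [phi ? ?] := fixed_colourings_character (a w); exists phi.
exists (\sum_w (-1) ^+ odd_perm w *: phi w) => [|s].
  by apply: rpred_sum => w _; rewrite rpredZsign char_vchar //; case: (phiP w).
rewrite sum_cfunE /frob_char rmorph_sum; apply: eq_bigr => w _.
by rewrite cfunE rmorphM rmorph_sign; case: (phiP w) => _ ->.
Qed.

Hypothesis n_inj : injective n.
Hypothesis sum_n : (\sum_j n j = #|T| + \sum_(j < r) j)%N.

(** A virtual character of norm 1 is an irreducible character up to sign. *)
Lemma frob_char_irr : exists b (i : Iirr G), forall s,
  (frob_char n s)%:~R = (-1) ^+ b * 'chi_i s.
Proof.
have [phi Zphi phiE] := frob_char_vchar.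
have [|b [i def_phi]] := vchar_norm1P Zphi.
  rewrite cfdotE; under eq_bigr => s _.
    rewrite phiE rmorph_int -intrM; over.
  rewrite (eq_bigl xpredT) => [|s]; last by rewrite inE.
  have -> : #|G| = #|T|`!.
    rewrite -[#|T|]cardsT -card_perm; apply: eq_card => s; rewrite inE.
    by apply/esym/subsetP=> x; rewrite !inE.
  rewrite -rmorph_sum /= frob_char_norm // -[X in _ * X]/(#|T|`!%:R).
  by rewrite mulVf // pnatr_eq0 -lt0n fact_gt0.
by exists b, i => s; rewrite -phiE def_phi cfunE.
Qed.

Lemma frob_char_dvd (s : {perm T}) : exists z : int,
  #|s ^: G|%:Z * frob_char n s = frob_char n (1%g : {perm T}) * z.
Proof.
have [b [i frobE]] := frob_char_irr.
have Gs : s \in G by rewrite inE.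
have := Aint_class_div_irr1 i Gs.
have chiE t : 'chi_i t = (-1) ^+ b * (frob_char n t)%:~R.
  by rewrite frobE mulrA -expr2 sqrr_sign mul1r.
have f1_neq0 : (frob_char n (1%g : {perm T}))%:~R != 0 :> algC.
  by rewrite frobE mulf_neq0 ?signr_eq0 ?irr1_neq0.
(* The unknown sign cancels in the quotient by the value at 1; what remains is a rational algebraic
   integer, hence an integer. *)
rewrite !chiE mulrCA -mulf_div divff ?signr_eq0 // mul1r => Az.
have /intrP[z ez] : #|s ^: G|%:R * (frob_char n s)%:~R / (frob_char n (1%g : {perm T}))%:~R
    \in (Num.int : {pred algC}).
  by apply: Cint_rat_Aint; rewrite ?Az // !(rpredM, rpredV, rpred_nat, rpred_int).
by exists z; apply: (@intr_inj algC); rewrite !rmorphM /= -ez [RHS]mulrC divfK.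
Qed.

(** The integers [z C] are chosen before the ring and the sequences [p] and [h], so they can be
    found in [algC] and used over polynomials. *)
Lemma schur_class_expansion : exists z : {set {perm T}} -> int,
  forall (B : comNzRingType) (p h : nat -> B), newton_upto p #|T| h ->
    #|T|`!%:R * \det (jacobi_trudi n h) =
    (frob_char n (1%g : {perm T}))%:~R *
      \sum_(C in classes G) (z C)%:~R * cyc_prod p (repr C).
Proof.
have [phi _ phiE] := frob_char_vchar.
have z_ex (C : {set {perm T}}) : exists z : int, C \in classes G ->
    #|C|%:Z * frob_char n (repr C) = frob_char n (1%g : {perm T}) * z.
  have [/repr_classesP[_ CE]|_] := boolP (C \in classes G); last by exists 0.
  by have [z zE] := frob_char_dvd (repr C); exists z => _; rewrite {1}CE.
have [z zP] := fin_all_exists z_ex.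
exists z => B p h nh; rewrite -(sum_frob_char sum_n nh).
rewrite (eq_bigl (fun s => s \in G)) => [|s]; last by rewrite inE.
rewrite sum_by_classes => [|s t _ _]; last first.
  congr (_%:~R * _); last exact: cyc_prodJ.
  by apply: (@intr_inj algC); rewrite -!phiE cfunJ ?inE.
rewrite mulr_sumr; apply: eq_bigr => C CG.
by rewrite !mulrA -[#|C|%:R]/(#|C|%:Z%:~R) -!rmorphM /= zP.
Qed.

End SymmetricGroup.

(** * Appell sequences *)

Section LogDerivative.
Variable R : numFieldType.

(** The power sums [k l_k] are the coefficients of [t] times the derivative of [log f]; the identity
    [f (log f)' = f'] is checked on truncations. *)
Lemma newton_log (f l : nat -> R) N : f 0%N = 1 ->
  (forall k, l k = \sum_(1 <= m < k.+1)
     ((-1) ^+ m.+1 / m%:R) * ((\poly_(j < k.+1) f j - 1) ^+ m)`_k) ->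
  newton_upto (fun k => k%:R * l k) N f.
Proof.
move=> f0 lE; split=> // m _; set K := m.+1.
pose F k := \poly_(j < k.+1) f j.
have F0 k : exists Q, F k - 1 = 'X * Q.
  exists (\poly_(j < k) f j.+1); apply/polyP=> -[|j]; rewrite coefB coefXM !coef_poly coef1 /=.
    by rewrite f0 subrr.
  by rewrite subr0.
pose g := F K - 1; have [g' gE] := F0 K; rewrite -/g in gE.
pose L := \sum_(1 <= i < K.+1) ((-1) ^+ i.+1 / i%:R) *: g ^+ i.
(* Powers of [g] above the [k]-th start beyond degree [k], and cutting [f] at degree [k] instead of
   [K] changes [g] by a multiple of ['X^(k.+1)]. *)
have lL k : (k <= K)%N -> l k = L`_k.
  move=> lekK; rewrite lE coef_sum [RHS](@big_cat_nat _ _ _ k.+1) //=.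
  rewrite [X in _ = _ + X]big_nat_cond [X in _ = _ + X]big1 ?addr0 => [|i /andP[/andP[ltki _] _]].
    apply: eq_big_nat => i /andP[i_gt0 _]; rewrite coefZ; congr (_ * _).
    have [Q QE] : exists Q, g = (F k - 1) + 'X^(k.+1) * Q.
      exists (\poly_(j < K - k) f (k.+1 + j)%N).
      rewrite /g addrAC; congr (_ - 1); apply/polyP=> j.
      rewrite coefD coefXnM !coef_poly; case: (ltnP j k.+1) => [ltjk|lekj].
        by rewrite addr0 (leq_trans ltjk).
      rewrite add0r subnKC // ltn_subLR // addnC.
      by rewrite (_ : _ + k.+1 = K.+1)%N // addnS subnK.
    suff [Q' ->] : exists Q', g ^+ i = (F k - 1) ^+ i + 'X^(k.+1) * Q'.
      by rewrite coefD coefXnM ltnSn addr0.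
    rewrite {1}QE; case: i i_gt0 => // i _; elim: i => [|i [Q' IH]]; first by exists Q.
    exists (Q' * (F k - 1 + 'X^(k.+1) * Q) + (F k - 1) ^+ i.+1 * Q).
    by rewrite exprSr IH [(F k - 1) ^+ i.+2]exprSr; ring.
  by rewrite coefZ gE exprMn coefXnM ltki mulr0.
(* [L'] is [g'] times a finite geometric sum and [F K = 1 + g]; the error has a factor [g ^+ K], so
   it is invisible in degree [m < K]. *)
have FL : F K * L^`() = g^`() * (1 - (- g) ^+ K).
  have -> : L^`() = g^`() * \sum_(i < K) (- g) ^+ i.
    rewrite /L raddf_sum /= big_add1 /= big_mkord mulr_sumr; apply: eq_bigr => i _.
    rewrite linearZ /= deriv_exp -scaler_nat scalerA divfK ?pnatr_eq0 //=.
    by rewrite [(- g) ^+ i]exprNn !exprS !mulN1r opprK -mul_polyC rmorph_sign mulrCA.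
  rewrite mulrCA; congr (_ * _).
  rewrite -[LHS]opprK -mulNr (_ : - F K = - g - 1); last first.
    by rewrite /g opprB addrAC subrr add0r.
  by rewrite -subrX1 opprB.
have : (F K * L^`())`_m = (F K)^`()`_m.
  rewrite FL (_ : (F K)^`() = g^`()); last by rewrite /g derivB derivC subr0.
  rewrite mulrBr mulr1 coefB gE exprNn exprMn mulrCA [_ * ('X^K * _)]mulrCA mulrCA.
  by rewrite coefXnM ltnSn subr0.
rewrite coef_deriv coef_poly ltnSn mulr_natl => <-.
rewrite mulrC coefM; apply: eq_bigr => k _.
rewrite coef_deriv lL // coef_poly ltnS mulr_natl.
by rewrite (leq_trans (leq_subr _ _)).
Qed.

End LogDerivative.

Section AppellNewton.
Variables (R : numFieldType) (A : nat -> {poly R}).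
Hypothesis appellA : appell A.

Definition appell_h k : {poly R} := (k`!%:R)^-1 *: A k.
(** Coefficient of [t^k] in [t] times the [t]-derivative of [xt + log f_A(t)], the logarithm of
    [e^{xt} f_A(t)]. *)
Definition appell_p k : {poly R} :=
  (k == 1%N)%:R *: 'X + (appell_c A k / (k.-1)`!%:R)%:P.

Lemma fact_neq0 k : k`!%:R != 0 :> R.
Proof. by rewrite pnatr_eq0 -lt0n fact_gt0. Qed.

Lemma deriv_appell_h k : (appell_h k.+1)^`() = appell_h k.
Proof.
rewrite /appell_h linearZ /= appellA.2 scalerA factS natrM invfM -mulrA.
by rewrite mulrCA mulVf ?mulr1 // pnatr_eq0.
Qed.

Lemma appell_h0 : appell_h 0 = 1.
Proof. by rewrite /appell_h appellA.1 fact0 invr1 scale1r. Qed.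

Lemma deriv_horner0_eq0 (q : {poly R}) : q^`() = 0 -> q.[0] = 0 -> q = 0.
Proof.
move=> dq q0; apply/polyP=> -[|i]; rewrite coef0; first by rewrite -horner_coef0.
have /eqP := congr1 (fun u : {poly R} => u`_i) dq.
by rewrite coef_deriv coef0 mulrn_eq0 => /eqP.
Qed.

Lemma newton_appell_at0 N :
  newton_upto (fun k => (appell_p k).[0]) N (fun k => (appell_h k).[0]).
Proof.
have : newton_upto (fun k => k%:R * logfA_coef A k) N (fA_coef A).
  apply: newton_log => //; first by rewrite /fA_coef appellA.1 hornerC fact0 divr1.
apply: eq_newton => [[//|k] _|k _].
  rewrite /appell_p hornerD hornerZ hornerX mulr0 add0r hornerC /appell_c factS.
  by rewrite natrM mulrAC mulfK ?fact_neq0.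
by rewrite /fA_coef /appell_h hornerZ mulrC.
Qed.

(** Induction on [m]: the difference of the two sides vanishes at 0, and its derivative is the
    difference for the preceding index. *)
Lemma newton_appell N : newton_upto appell_p N appell_h.
Proof.
split=> [|m _]; first exact: appell_h0.
apply/eqP; rewrite -subr_eq0; apply/eqP.
have deriv_p k : (appell_p k.+1)^`() = (k == 0%N)%:R.
  rewrite /appell_p derivD derivZ derivX derivC addr0 eqSS.
  by case: (k == _); rewrite ?scale1r ?scale0r.
have at0 k : (k.+1%:R * appell_h k.+1 -
    \sum_(i < k.+1) appell_p i.+1 * appell_h (k - i)).[0] = 0.
  have /(_ k (ltnSn _)) E := (newton_appell_at0 k.+1).2.
  rewrite hornerD hornerN hornerM -polyC_natr hornerC E horner_sum.
  by apply/eqP; rewrite subr_eq0; apply/eqP/eq_bigr => i _; rewrite hornerM.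
elim: m => [|m IHm]; apply: deriv_horner0_eq0.
- rewrite big_ord1 mul1r appell_h0 mulr1 derivB deriv_appell_h appell_h0 deriv_p.
  exact: subrr.
- exact: at0.
- rewrite -[RHS]IHm derivB.
  rewrite derivM -[m.+2%:R]polyC_natr derivC mul0r add0r deriv_appell_h polyC_natr.
  rewrite raddf_sum /= (eq_bigr (fun k : 'I_m.+2 => (k == 0%N :> nat)%:R * appell_h (m.+1 - k) +
     appell_p k.+1 * (appell_h (m.+1 - k))^`())); last first.
    by move=> k _; rewrite derivM deriv_p.
  rewrite big_split /= big_ord_recl /= big1 ?addr0 ?mul1r; last first.
    by move=> k _; rewrite mul0r.
  rewrite big_ord_recr /= subnn appell_h0 derivC mulr0 addr0 subn0.
  (* The derivative of [appell_p 1] contributes one [appell_h m.+1], which lowers the factor [m.+2]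
     to [m.+1]. *)
  rewrite opprD addrA mulrSr mulrDl mul1r addrK; congr (_ - _).
  apply: eq_bigr => k _; have lekm : (k <= m)%N by rewrite -ltnS.
  by rewrite /= subSn // deriv_appell_h.
- exact: at0.
Qed.

Lemma derivn_appell n i :
  (A n)^`(i) = if (i <= n)%N then (n`!%:R)%:P * appell_h (n - i) else 0.
Proof.
elim: i => [|i IHi].
  by rewrite subn0 derivn0 mul_polyC /appell_h scalerA divff ?scale1r ?fact_neq0.
rewrite derivnS IHi; case: ltngtP => [ltin|ltni|->].
- by rewrite -subSS subSn // derivM derivC mul0r add0r deriv_appell_h.
- by rewrite deriv0.
- by rewrite subnn appell_h0 mulr1 derivC.
Qed.

Lemma wronskian_part_jacobi_trudi la :
  wronskian_part A la = (\prod_(j < size la) (part_n la j)`!%:R)%:P *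
    \det (jacobi_trudi (fun j : 'I_(size la) => part_n la j) appell_h).
Proof.
rewrite /wronskian_part mulrC rmorph_prod.
rewrite (_ : \prod_(j < _) _ =
   \det (diag_mx (\row_(j < size la) ((part_n la j)`!%:R : R)%:P))); last first.
  by rewrite det_diag; apply: eq_bigr => j _; rewrite mxE.
rewrite -det_mulmx; congr (\det _); apply/matrixP=> i j.
rewrite mul_mx_diag !mxE derivn_appell; case: ifP => _; last by rewrite mul0r.
by rewrite mulrC.
Qed.

End AppellNewton.

(** * The value of the Frobenius character at the identity *)

Section Degree.
Variables (R : numFieldType) (T : finType) (r : nat) (n : 'I_r -> nat).
Hypothesis sum_n : (\sum_j n j = #|T| + \sum_(j < r) j)%N.

Lemma cyc_prod_delta (s : {perm T}) :
  cyc_prod (fun k => (k == 1%N)%:R : R) s = (s == 1%g)%:R.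
Proof.
rewrite /cyc_prod; have [->|s_neq1] := eqVneq s 1%g.
  by rewrite big1 // => _ /imsetP[x _ ->]; rewrite porbit_fix ?perm1 // cards1.
have /existsP[x sx] : [exists x, s x != x].
  rewrite -negb_forall; apply: contra s_neq1 => /forallP fs.
  by apply/eqP/permP=> x; rewrite perm1 (eqP (fs x)).
rewrite (bigD1 (porbit s x)) ?imset_f //=.
suff /negPf-> : #|porbit s x| != 1%N by rewrite mul0r.
apply: contra sx => /cards1P[z zE].
have := porbit_id s x; have := mem_porbit s 1 x.
by rewrite expg1 zE !inE => /eqP-> /eqP->.
Qed.

Lemma newton_exp N :
  newton_upto (fun k => (k == 1%N)%:R) N (fun k => (k`!%:R)^-1 : R).
Proof.
split=> [|m _]; first by rewrite invr1.
rewrite big_ord_recl /= mul1r subn0 big1 ?addr0 => [|k _]; last by rewrite mul0r.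
by rewrite factS natrM invfM mulrA mulfV ?mul1r // pnatr_eq0.
Qed.

(** Falling factorials are monic polynomials of degree [i] in [n j], so a unitriangular factor
    separates this matrix from the Vandermonde matrix. *)
Lemma det_falling_factorial :
  \det (\matrix_(i < r, j < r) ((n j) ^_ i)%:R : 'M[R]_r) =
  \prod_(i < r) \prod_(j < r | (i < j)%N) ((n j)%:R - (n i)%:R).
Proof.
pose q i : {poly R} := \prod_(k < i) ('X - k%:R%:P).
have qE m i : (q i).[m%:R] = (m ^_ i)%:R.
  rewrite /q horner_prod ffact_prod natr_prod; have [leim|ltmi] := leqP i m.
    apply: eq_bigr => k _; rewrite !hornerE natrB //.
    exact: leq_trans (ltnW (ltn_ord k)) leim.
  rewrite (bigD1 (Ordinal ltmi)) //= !hornerE subrr mul0r.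
  by rewrite (bigD1 (Ordinal ltmi)) //= subnn mul0r.
have monic_q i : q i \is monic by apply: monic_prod_XsubC.
have size_q i : size (q i) = i.+1.
  by rewrite /q size_prod_XsubC -[index_enum _]enumT size_enum_ord.
pose a : 'rV[R]_r := \row_j (n j)%:R.
have -> : \matrix_(i < r, j < r) ((n j) ^_ i)%:R =
    \matrix_(i < r, k < r) (q i)`_k *m Vandermonde r a.
  apply/matrixP=> i j; rewrite !mxE -qE (@horner_coef_wide _ r) ?size_q //.
  by apply: eq_bigr => k _; rewrite !mxE.
rewrite det_mulmx det_trig; last first.
  by apply/is_trig_mxP=> i j ltij; rewrite mxE nth_default // size_q.
rewrite big1 ?mul1r => [|i _]; last first.
  by have /monicP := monic_q i; rewrite mxE lead_coefE size_q.
rewrite det_Vandermonde; apply: eq_bigr => i _; apply: eq_bigr => j _.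
by rewrite !mxE.
Qed.

(** The exponential specialization [p_k = [k = 1]], [h_k = 1/k!] kills every cycle product but that
    of the identity, and [n_j! / (n_j - i)!] is a falling factorial. *)
Lemma frob_char1 :
  (frob_char n (1%g : {perm T}))%:~R * \prod_j (n j)`!%:R =
  #|T|`!%:R * \prod_(i < r) \prod_(j < r | (i < j)%N) ((n j)%:R - (n i)%:R) :> R.
Proof.
have := sum_frob_char sum_n (newton_exp #|T|).
rewrite (bigD1 1%g) //= [X in _ + X]big1 => [|s s_neq1]; last first.
  by rewrite cyc_prod_delta (negPf s_neq1) mulr0.
rewrite cyc_prod_delta eqxx mulr1 addr0 => ->; rewrite -mulrA; congr (_ * _).
rewrite -det_falling_factorial.
rewrite (_ : \prod_(j < _) _ = \det (diag_mx (\row_(j < r) ((n j)`!%:R : R)))); last first.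
  by rewrite det_diag; apply: eq_bigr => j _; rewrite mxE.
rewrite -det_mulmx; congr (\det _); apply/matrixP=> i j.
rewrite mul_mx_diag !mxE; case: leqP => [lein|ltni]; last first.
  by rewrite mul0r ffact_small.
by rewrite -(ffact_fact lein) natrM mulrC mulfK // fact_neq0.
Qed.

End Degree.

(** * Polynomials with integer coefficients *)

Section IntegerCoefficients.
Variable R : numFieldType.

Definition int_poly (q : {poly R}) := exists q' : {poly int}, q = map_poly intr q'.

Lemma int_polyD q1 q2 : int_poly q1 -> int_poly q2 -> int_poly (q1 + q2).
Proof. by move=> [u ->] [v ->]; exists (u + v); rewrite rmorphD. Qed.

Lemma int_polyM q1 q2 : int_poly q1 -> int_poly q2 -> int_poly (q1 * q2).
Proof. by move=> [u ->] [v ->]; exists (u * v); rewrite rmorphM. Qed.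

Lemma int_poly_int (z : int) : int_poly z%:~R.
Proof. by exists z%:P; rewrite map_polyC /= rmorph_int. Qed.

Lemma int_polyC (x : R) : is_int x -> int_poly x%:P.
Proof. by move=> [z ->]; exists z%:P; rewrite map_polyC. Qed.

Lemma int_polyX : int_poly 'X.
Proof. by exists 'X; rewrite map_polyX. Qed.

Lemma int_poly_coef q i : int_poly q -> is_int q`_i.
Proof. by move=> [u ->]; exists u`_i; rewrite coef_map. Qed.

End IntegerCoefficients.

(** * Shifted parts of a partition and integrality of [A_lambda] *)

Lemma part_n_ltn la i j : sorted geq la -> (i < j < size la)%N ->
  (part_n la i < part_n la j)%N.
Proof.
move=> sla /andP[ltij ltj]; rewrite /part_n -addnS leq_add //.
have idx k : (size la - 1 - k < size la)%N.
  by rewrite -subnDA ltn_subrL add1n (leq_ltn_trans _ ltj).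
apply: (sorted_leq_nth _ _ 0%N sla); rewrite ?inE //.
- by move=> x y z /= h1 h2; apply: leq_trans h2 h1.
- by move=> x /=.
- by rewrite leq_sub2l // ltnW.
Qed.

Lemma part_n_inj la : sorted geq la -> injective (fun j : 'I_(size la) => part_n la j).
Proof.
move=> sla i j eij; apply/val_inj; apply/eqP; case: ltngtP => // lt_ij.
  by have := @part_n_ltn la i j sla; rewrite lt_ij ltn_ord eij ltnn => /(_ isT).
by have := @part_n_ltn la j i sla; rewrite lt_ij ltn_ord eij ltnn => /(_ isT).
Qed.

Theorem theorem5p8 (R : numFieldType) (A : nat -> {poly R}) :
  appell A ->
  (forall k : nat, (0 < k)%N -> is_int (appell_c A k / ((k.-1)`!)%:R)) ->
  forall la : seq nat, is_partition la ->
    forall i : nat, is_int (appell_schur A la)`_i.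
Proof.
move=> appellA int_c la [sla _] i; apply: int_poly_coef.
pose n (j : 'I_(size la)) := part_n la j.
pose N := (\sum_(j < size la) nth 0%N la (size la - 1 - j))%N.
have sum_n : (\sum_j n j = #|'I_N| + \sum_(j < size la) j)%N.
  by rewrite card_ord -big_split.
have [z zP] := schur_class_expansion (part_n_inj sla) sum_n.
have := zP _ _ _ (newton_appell appellA #|'I_N|).
set S := \sum_(C in _) _ => detE.
(* Orbits are nonempty, so the hypothesis on [c_k / (k-1)!] applies to each orbit length and every
   factor lies in Z[x]. *)
have intS : int_poly S.
  apply: big_ind => [||C _]; [exact: (int_poly_int R 0) | exact: int_polyD |].
  apply: int_polyM; first exact: int_poly_int.
  apply: big_ind => [||D /imsetP[x _ ->]]; [exact: (int_poly_int R 1) | exact: int_polyM |].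
  apply: int_polyD; last by apply/int_polyC/int_c; rewrite lt0n card_porbit_neq0.
  rewrite -mul_polyC; apply: int_polyM; last exact: int_polyX.
  by apply: int_polyC; exists (#|porbit (repr C) x| == 1%N)%:R; rewrite rmorph_nat.
suff -> : appell_schur A la = S by [].
pose V := \prod_(i < size la) \prod_(j < size la | (i < j)%N) ((n j)%:R - (n i)%:R) : R.
have V_neq0 : V != 0.
  apply/prodf_neq0=> k _; apply/prodf_neq0=> j ltkj.
  by rewrite subr_eq0 eqr_nat gtn_eqF // part_n_ltn // ltkj /=.
pose P := \prod_j (n j)`!%:R : R.
have frobE := frob_char1 R sum_n; rewrite -/P -/V in frobE.
rewrite /appell_schur wronskian_part_jacobi_trudi // -mul_polyC.
rewrite -[vandermonde_part R la]/V -[\prod_(j < size la) _]/P -/n.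
set D := \det _ in detE *.
(* Multiplied by [N! V = chi(1) P], the left side becomes [N! P D], which [detE] equates with
   [chi(1) P S]. *)
have NV_neq0 : (#|'I_N|`!%:R * V)%:P != 0 by rewrite polyC_eq0 mulf_neq0 ?fact_neq0.
apply: (mulfI NV_neq0); rewrite -{2}frobE !polyCM.
rewrite (_ : (_%:~R)%:P = (frob_char n (1%g : 'S_N))%:~R); last by rewrite rmorph_int.
rewrite [RHS]mulrAC -detE polyC_natr mulrA -[_ * _ * V^-1%:P]mulrA -polyCM mulfV //.
by rewrite polyC1 mulr1 [RHS]mulrAC mulrA.
Qed.
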